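(* For every $n\ge1$, $D_n^{S_n}\cong D_n$.
   Context: Let $\Bbbk$ be an algebraically closed field of characteristic $0$. The $n$-th Weyl algebra $A_n$ over $\Bbbk$ is generated by $x_1,\dots,x_n,\partial_1,\dots,\partial_n$ subject to $$x_ix_j=x_jx_i,\qquad \partial_i\partial_j=\partial_j\partial_i,\qquad \partial_ix_j-x_j\partial_i=\delta_{ij}.$$ $D_n$ denotes its skew field of fractions. The symmetric group $S_n$ acts on $A_n$, and hence on $D_n$, by simultaneously permuting the $x_i$ and the $\partial_i$: $\sigma(x_i)=x_{\sigma(i)}$ and $\sigma(\partial_i)=\partial_{\sigma(i)}$. $D_n^{S_n}$ is the subfield of invariants. *)

(* Defs.v *)
From HB Require Import structures.
From mathcomp Require Import all_boot all_order all_algebra all_fingroup.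
Set Implicit Arguments. Unset Strict Implicit. Unset Printing Implicit Defensive.
Import Order.TTheory GRing.Theory Num.Theory.
Local Open Scope ring_scope.

Definition is_division_ring (R : unitRingType) : Prop :=
  forall q : R, q != 0 -> q \is a GRing.unit.

Definition weyl_relations (k : fieldType) (D : unitAlgType k) (n : nat)
    (x d : 'I_n -> D) : Prop :=
  [/\ forall i j, x i * x j = x j * x i,
      forall i j, d i * d j = d j * d i &
      forall i j, d i * x j - x j * d i = (i == j)%:R].

Definition weyl_mono (k : fieldType) (D : unitAlgType k) (n : nat)
    (x d : 'I_n -> D) (a b : 'I_n -> nat) : D :=
  (\prod_(i < n) x i ^+ a i) * (\prod_(i < n) d i ^+ b i).

(* The standard monomials are linearly independent over k, i.e. the
   subalgebra generated by x, d is (a copy of) the Weyl algebra A_n. *)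
Definition weyl_free (k : fieldType) (D : unitAlgType k) (n : nat)
    (x d : 'I_n -> D) : Prop :=
  forall (N : nat) (c : {ffun 'I_n -> 'I_N} -> {ffun 'I_n -> 'I_N} -> k),
    \sum_(a : {ffun 'I_n -> 'I_N}) \sum_(b : {ffun 'I_n -> 'I_N})
        c a b *: weyl_mono x d (fun i => nat_of_ord (a i)) (fun i => nat_of_ord (b i)) = 0 ->
    forall a b, c a b = 0.

Definition in_weyl (k : fieldType) (D : unitAlgType k) (n : nat)
    (x d : 'I_n -> D) (u : D) : Prop :=
  exists (N : nat) (c : {ffun 'I_n -> 'I_N} -> {ffun 'I_n -> 'I_N} -> k),
    u = \sum_(a : {ffun 'I_n -> 'I_N}) \sum_(b : {ffun 'I_n -> 'I_N})
          c a b *: weyl_mono x d (fun i => nat_of_ord (a i)) (fun i => nat_of_ord (b i)).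

Definition weyl_fractions (k : fieldType) (D : unitAlgType k) (n : nat)
    (x d : 'I_n -> D) : Prop :=
  forall q : D, exists a b : D,
    [/\ in_weyl x d a, in_weyl x d b, b != 0 & q = a / b].

(* So (D, x, d) with the properties above is a model of D_n (unique up to
   isomorphism by the universal property of Ore localization). *)
Definition is_weyl_skew_field (k : fieldType) (D : unitAlgType k) (n : nat)
    (x d : 'I_n -> D) : Prop :=
  [/\ is_division_ring D, weyl_relations x d, weyl_free x d & weyl_fractions x d].

Definition is_alg_hom (k : fieldType) (A B : unitAlgType k) (f : A -> B) : Prop :=
  [/\ f 1 = 1,
      forall u v, f (u + v) = f u + f v,
      forall u v, f (u * v) = f u * f v &
      forall (c : k) u, f (c *: u) = c *: f u].

Definition is_Sn_action (k : fieldType) (D : unitAlgType k) (n : nat)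
    (x d : 'I_n -> D) (sigma : 'S_n -> D -> D) : Prop :=
  forall s : 'S_n,
    [/\ is_alg_hom (sigma s), bijective (sigma s),
        forall i, sigma s (x i) = x (s i) &
        forall i, sigma s (d i) = d (s i)].

Definition Sn_invariant (k : fieldType) (D : unitAlgType k) (n : nat)
    (sigma : 'S_n -> D -> D) (q : D) : Prop :=
  forall s : 'S_n, sigma s q = q.

(* Main.v *)
Require Import Defs.
From HB Require Import structures.
From mathcomp Require Import all_boot all_order all_algebra all_fingroup.
From mathcomp Require boolp.
Import GRing.Theory.
Local Open Scope ring_scope.
Set Implicit Arguments.
Unset Strict Implicit.
Unset Printing Implicit Defensive.

(** Let y_1, ..., y_n be the coefficients of P(T) = (T - x_1) ... (T - x_n), i.e.
    the elementary symmetric functions up to sign.  Lagrange interpolation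
    inverts their Jacobian matrix and gives vector fields delta_l = d/dy_l, so
    (y, delta) satisfies the Weyl relations.  The Weyl algebra is simple in
    characteristic 0, so x |-> y, d |-> delta extends to an embedding f of D.
    Its image E consists of invariants, because a vector field is determined
    by its values on the y_l.

    Conversely, since P(x_i) = 0, the right E-space V spanned by the monomials
    x^a is finite-dimensional.  It is stable under left multiplication by the
    x_i and the d_i, hence, injective endomorphisms of V being onto, by their
    fractions; so V = D.  Averaging q = sum_a x^a e_a over S_n, an invariant q lies in
    E as soon as the symmetrized monomials do.  These are permanents, and
    Ryser's formula writes them as combinations of products g(x_1) ... g(x_n)
    with g a polynomial over k; as k is algebraically closed, such a product
    is, up to scalars, a product of values P(z), z in k. *)

(** * Commutators and simplicity of the Weyl algebra *)

HB.lock Definition bracket (R : pzRingType) (a b : R) := a * b - b * a.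

Section Bracket.
Variable R : pzRingType.
Implicit Types a b c : R.

Lemma bracketE a b : bracket a b = a * b - b * a.
Proof. by rewrite bracket.unlock. Qed.

Lemma bracket_eq0 a b : bracket a b = 0 <-> GRing.comm a b.
Proof.
by rewrite bracketE /GRing.comm; split=> [/eqP|->]; rewrite ?subrr // subr_eq0 => /eqP.
Qed.

Lemma bracketC a b : bracket a b = - bracket b a.
Proof. by rewrite !bracketE opprB. Qed.

Lemma bracketMr a b c : bracket a (b * c) = bracket a b * c + b * bracket a c.
Proof. by rewrite !bracketE mulrBl mulrBr !mulrA addrA subrK. Qed.

Lemma bracketMl a b c : bracket (a * b) c = a * bracket b c + bracket a c * b.
Proof. by rewrite !bracketE mulrBl mulrBr !mulrA addrA subrK. Qed.

Lemma bracketDr a b c : bracket a (b + c) = bracket a b + bracket a c.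
Proof. by rewrite !bracketE mulrDl mulrDr opprD addrACA. Qed.

Lemma bracketDl a b c : bracket (a + b) c = bracket a c + bracket b c.
Proof. by rewrite !bracketE mulrDl mulrDr opprD addrACA. Qed.

Lemma bracket0r a : bracket a 0 = 0.
Proof. by rewrite !bracketE mulr0 mul0r subrr. Qed.

Lemma bracket0l a : bracket 0 a = 0.
Proof. by rewrite !bracketE mulr0 mul0r subrr. Qed.

Lemma bracket_sumr (I : Type) (r : seq I) (P : pred I) (F : I -> R) a :
  bracket a (\sum_(i <- r | P i) F i) = \sum_(i <- r | P i) bracket a (F i).
Proof. exact: (big_morph _ (bracketDr a) (bracket0r a)). Qed.

Lemma bracket_suml (I : Type) (r : seq I) (P : pred I) (F : I -> R) a :
  bracket (\sum_(i <- r | P i) F i) a = \sum_(i <- r | P i) bracket (F i) a.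
Proof. by apply: (big_morph (fun b => bracket b a)) => [b c|]; rewrite ?bracketDl ?bracket0l. Qed.

Lemma bracketNl a b : bracket (- a) b = - bracket a b.
Proof. by rewrite !bracketE mulrN mulNr opprB opprK addrC. Qed.

Lemma bracket_jacobi a b c :
  bracket (bracket a b) c = bracket a (bracket b c) - bracket b (bracket a c).
Proof.
rewrite [bracket a b]bracketE bracketDl bracketNl !bracketMl.
rewrite [bracket a (bracket _ _)]bracketE [bracket b (bracket a c)]bracketE.
by rewrite opprB opprD [in LHS]addrAC -addrA -!addrA; congr (_ + _); rewrite addrCA;
  congr (_ + _); rewrite addrC.
Qed.
End Bracket.

Section Weyl.
Variables (k : fieldType) (B : unitAlgType k) (n : nat) (X D : 'I_n -> B).
Hypothesis WR : weyl_relations X D.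

Let XX i j : bracket (X i) (X j) = 0. Proof. by case: WR => h _ _; apply/bracket_eq0/h. Qed.
Let DD i j : bracket (D i) (D j) = 0. Proof. by case: WR => _ h _; apply/bracket_eq0/h. Qed.
Let DX i j : bracket (D i) (X j) = (i == j)%:R. Proof. by case: WR => _ _ h; rewrite bracketE. Qed.

Lemma bracketZr a (c : k) (b : B) : bracket a (c *: b) = c *: bracket a b.
Proof. by rewrite !bracketE scalerBr -scalerAr -scalerAl. Qed.

Lemma bracketZl a (c : k) (b : B) : bracket (c *: b) a = c *: bracket b a.
Proof. by rewrite !bracketE scalerBr -scalerAr -scalerAl. Qed.

(* The span of the normally ordered words of length [m]: multiplying by [X] on the
   left and by [D] on the right keeps a word normally ordered. *)
Inductive graded : nat -> B -> Prop :=
| graded0 m : graded m 0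
| graded1 : graded 0 1
| gradedX m i u : graded m u -> graded m.+1 (X i * u)
| gradedD m i u : graded m u -> graded m.+1 (u * D i)
| gradedA m u v : graded m u -> graded m v -> graded m (u + v)
| gradedZ m c u : graded m u -> graded m (c *: u).

(** On normally ordered words, bracketing with [D i] differentiates in [X i] and bracketing with
    [X i] differentiates in [D i]; this is the Euler field of the symbol. *)
Definition euler (u : B) := \sum_i (X i * bracket (D i) u + bracket u (X i) * D i).

(** By the Leibniz rule a new letter [X j] or [D j] adds one copy of the word: only the term [i = j]
    survives, letters of the same kind commuting. *)
Lemma euler_graded m u : graded m u -> euler u = u *+ m.
Proof.
elim=> {m u}.
- by move=> m; rewrite /euler big1 ?mul0rn // => i _; rewrite bracket0r bracket0l mulr0 mul0r addr0.
- rewrite /euler big1 // => i _.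
  by rewrite !bracketE !mul1r !mulr1 !subrr mulr0 mul0r addr0.
- move=> m j u _ IH; rewrite mulrS -mulrnAr -IH /euler mulr_sumr.
  rewrite (eq_bigr (fun i => X i * (i == j)%:R * u + X j * (X i * bracket (D i) u + bracket u
    (X i) * D i))).
    by rewrite big_split /= -mulr_suml (bigD1 j) //= eqxx mulr1 big1 ?addr0 // => i /negPf ->;
      rewrite mulr0.
  move=> i _; rewrite bracketMr bracketMl XX mul0r addr0 DX !mulrDr !mulrA addrA.
  by have /bracket_eq0 -> := XX i j.
- move=> m j u _ IH; rewrite mulrS -mulrnAl -IH /euler mulr_suml.
  rewrite (eq_bigr (fun i => u * ((j == i)%:R * D i) + (X i * bracket (D i) u + bracket u (X i)
    * D i) * D j)).
    rewrite big_split /= -mulr_sumr (bigD1 j) //= eqxx mul1r big1 ?addr0 // => i.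
    by rewrite eq_sym => /negPf ->; rewrite mul0r.
  move=> i _; rewrite bracketMr bracketMl DD mulr0 addr0 DX !mulrDl -!mulrA addrCA;
    do 2!congr (_ + _).
  by have /bracket_eq0 -> := DD j i.
- move=> m u v _ IHu _ IHv; rewrite mulrnDl -IHu -IHv /euler -big_split; apply: eq_bigr => i _ /=.
  by rewrite bracketDr bracketDl mulrDr mulrDl addrACA.
- move=> m c u _ IH; rewrite scalerMnr -IH /euler scaler_sumr; apply: eq_bigr => i _.
  by rewrite bracketZr bracketZl scalerDr scalerAr scalerAl.
Qed.

(** [m.-1] stops at 0, so the vanishing in degree 0 is carried along; the induction uses it when a
    letter is added to a word of length 0. *)
Lemma bracket_D_graded i m u :
  graded m u -> graded m.-1 (bracket (D i) u) /\ (m = 0%N -> bracket (D i) u = 0).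
Proof.
elim=> {m u}.
- by move=> m; rewrite bracket0r; split=> //; constructor.
- by rewrite !bracketE mulr1 mul1r subrr; split=> //; constructor.
- move=> m j u hu [IH1 IH0]; split=> //=; rewrite bracketMr DX; apply: gradedA.
    by rewrite -mulr_natl mulr1 -(scaler_nat _ (1 : B)) -scalerAl mul1r; apply: gradedZ.
  case: m hu IH1 IH0 => [|m] hu IH1 IH0; first by rewrite IH0 // mulr0; constructor.
  exact: gradedX.
- move=> m j u hu [IH1 IH0]; split=> //=; rewrite bracketMr DD mulr0 addr0.
  case: m hu IH1 IH0 => [|m] hu IH1 IH0; first by rewrite IH0 // mul0r; constructor.
  exact: gradedD.
- move=> m u v _ [IHu IHu0] _ [IHv IHv0]; rewrite bracketDr; split; first exact: gradedA.
  by move=> m0; rewrite IHu0 // IHv0 // addr0.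
- move=> m c u _ [IH IH0]; rewrite bracketZr; split; first exact: gradedZ.
  by move=> m0; rewrite IH0 // scaler0.
Qed.

Lemma bracket_X_graded i m u :
  graded m u -> graded m.-1 (bracket u (X i)) /\ (m = 0%N -> bracket u (X i) = 0).
Proof.
elim=> {m u}.
- by move=> m; rewrite bracket0l; split=> //; constructor.
- by rewrite !bracketE mulr1 mul1r subrr; split=> //; constructor.
- move=> m j u hu [IH1 IH0]; split=> //=; rewrite bracketMl XX mul0r addr0.
  case: m hu IH1 IH0 => [|m] hu IH1 IH0; first by rewrite IH0 // mulr0; constructor.
  exact: gradedX.
- move=> m j u hu [IH1 IH0]; split=> //=; rewrite bracketMl DX; apply: gradedA.
    by rewrite -mulr_natl mulr1 -(scaler_nat _ (1 : B)) -scalerAr mulr1; apply: gradedZ.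
  case: m hu IH1 IH0 => [|m] hu IH1 IH0; first by rewrite IH0 // mul0r; constructor.
  exact: gradedD.
- move=> m u v _ [IHu IHu0] _ [IHv IHv0]; rewrite bracketDl; split; first exact: gradedA.
  by move=> m0; rewrite IHu0 // IHv0 // addr0.
- move=> m c u _ [IH IH0]; rewrite bracketZl; split; first exact: gradedZ.
  by move=> m0; rewrite IH0 // scaler0.
Qed.

Lemma graded_0_scalar u : graded 0 u -> exists c : k, u = c%:A.
Proof.
move: {1 3}0%N (erefl 0%N) => m m0 h; elim: h m0 => {m u} //.
- by move=> m _; exists 0; rewrite scale0r.
- by exists 1; rewrite scale1r.
- by move=> m u v _ IHu _ IHv m0; have [a ->] := IHu m0; have [b ->] := IHv m0; exists (a + b);
  rewrite scalerDl.
- by move=> m c u _ IHu m0; have [a ->] := IHu m0; exists (c * a); rewrite scalerA.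
Qed.

(** Degree strictly below [m], so that [filtered 0] means zero and starts the induction on the
    order. *)
Definition filtered m (u : B) :=
  exists2 g : nat -> B, forall j, graded j (g j) & u = \sum_(j < m) g j.

Lemma graded_MnM m u j : graded m u -> graded m (u *+ j).
Proof. by move=> h; rewrite -scaler_nat; apply: gradedZ. Qed.

(* [euler] preserves [I], kills its elements of least order, and acts on the top
   graded piece by its degree. *)
Lemma weyl_simple (I : B -> Prop) :
    [pchar k] =i pred0 ->
    (forall u v, I u -> I v -> I (u + v)) -> (forall c u, I u -> I (c *: u)) ->
    (forall u i, I u -> I (X i * u)) -> (forall u i, I u -> I (u * X i)) ->
    (forall u i, I u -> I (D i * u)) -> (forall u i, I u -> I (u * D i)) ->
    (forall c : k, I c%:A -> c%:A = 0 :> B) ->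
  forall m u, filtered m u -> I u -> u = 0.
Proof.
move=> ch0 IA IZ IXl IXr IDl IDr I1.
have IN u : I u -> I (- u) by move=> /(IZ (-1)); rewrite scaleN1r.
elim=> [u [g _ ->] _|m IH u [g gg Eu] Iu]; first by rewrite big_ord0.
have D0 i : bracket (D i) u = 0.
  apply: IH; last by rewrite bracketE; apply: IA; [apply: IDl | apply/IN/IDr].
  exists (fun j => bracket (D i) (g j.+1)); first by move=> j; case: (bracket_D_graded i (gg j.+1)).
  by rewrite Eu bracket_sumr big_ord_recl (bracket_D_graded i (gg 0%N)).2 // add0r.
have X0 i : bracket u (X i) = 0.
  apply: IH; last by rewrite bracketE; apply: IA; [apply: IXr | apply/IN/IXl].
  exists (fun j => bracket (g j.+1) (X i)); first by move=> j; case: (bracket_X_graded i (gg j.+1)).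
  by rewrite Eu bracket_suml big_ord_recl (bracket_X_graded i (gg 0%N)).2 // add0r.
have E0 : euler u = 0 by apply: big1 => i _; rewrite D0 X0 mulr0 mul0r addr0.
have EE : euler u = \sum_(j < m.+1) g j *+ j.
  transitivity (\sum_i \sum_(j < m.+1) (X i * bracket (D i) (g j) + bracket (g j) (X i) * D i)).
    by apply: eq_bigr => i _; rewrite Eu bracket_sumr bracket_suml mulr_sumr mulr_suml -big_split.
  by rewrite exchange_big /=; apply: eq_bigr => j _; rewrite -(euler_graded (gg j)).
(* In [u *+ m - euler u] the piece of degree [j] is multiplied by [m - j], so the top piece
   disappears and the order drops. *)
have um : u *+ m = 0.
  apply: IH; last by rewrite -scaler_nat; apply: IZ.
  exists (fun j => g j *+ (m - j)); first by move=> j; apply: graded_MnM.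
  have -> : u *+ m = u *+ m - euler u by rewrite E0 subr0.
  rewrite EE Eu -sumrMnl -sumrB big_ord_recr /= subrr addr0.
  by apply: eq_bigr => j _; rewrite mulrnBr // ltnW.
(* For positive [m], divide by [m] in characteristic 0; for [m = 0], [u] is a scalar and the last
   hypothesis on [I] applies. *)
case: m {IH gg E0 EE} um Eu (gg) => [_|m um _ _]; last first.
  apply/eqP; move: um => /eqP; rewrite -scaler_nat scaler_eq0 (pcharf0P k).1 //.
rewrite big_ord_recl big_ord0 addr0 => Eu gg.
have [c Ec] := graded_0_scalar (gg 0%N).
by rewrite Eu Ec; apply: I1; rewrite -Ec -Eu.
Qed.

Definition weyl_sub (u : B) := exists m, filtered m u.

Lemma weyl_sub_graded m u : graded m u -> weyl_sub u.
Proof.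
move=> h; exists m.+1, (fun j => if j == m then u else 0).
  by move=> j; case: eqP => [->|_] //; constructor.
rewrite big_ord_recr /= eqxx big1 ?add0r // => j _.
by rewrite ltn_eqF.
Qed.

Lemma weyl_subD u v : weyl_sub u -> weyl_sub v -> weyl_sub (u + v).
Proof.
suff W m m' g g' : (m <= m')%N -> (forall j, graded j (g j)) -> (forall j, graded j (g' j)) ->
    weyl_sub (\sum_(j < m) g j + \sum_(j < m') g' j).
  move=> [m [g hg ->]] [m' [g' hg' ->]].
  by have [/W|/ltnW/W h] := leqP m m'; [apply | rewrite addrC; apply: h].
move=> mm hg hg'; exists m', (fun j => (if (j < m)%N then g j else 0) + g' j).
  by move=> j; apply: gradedA => //; case: ifP => // _; constructor.
by rewrite big_split /= (big_ord_widen m' g mm) big_mkcond.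
Qed.

Lemma weyl_sub_ind (Q : B -> Prop) :
    (forall m u, graded m u -> Q u) -> (forall u v, Q u -> Q v -> Q (u + v)) ->
  forall u, weyl_sub u -> Q u.
Proof.
move=> Q1 QD u [m [g hg ->]]; apply: big_ind => //; first by apply: (Q1 0%N); constructor.
by move=> i _; apply: Q1 (hg i).
Qed.

Lemma weyl_subZ c u : weyl_sub u -> weyl_sub (c *: u).
Proof.
move: u; apply: weyl_sub_ind => [m u h|u v]; first by apply: weyl_sub_graded (gradedZ c h).
by rewrite scalerDr; apply: weyl_subD.
Qed.

Lemma weyl_subMX i u : weyl_sub u -> weyl_sub (X i * u).
Proof.
move: u; apply: weyl_sub_ind => [m u h|u v]; first by apply: weyl_sub_graded (gradedX i h).
by rewrite mulrDr; apply: weyl_subD.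
Qed.

(** Moving [D i] to the right end of a word costs only a bracket, which is again graded. *)
Lemma weyl_subMD i u : weyl_sub u -> weyl_sub (D i * u).
Proof.
move: u; apply: weyl_sub_ind => [m u h|u v]; last by rewrite mulrDr; apply: weyl_subD.
have -> : D i * u = u * D i + bracket (D i) u by rewrite !bracketE addrC subrK.
apply: weyl_subD; first by apply: weyl_sub_graded (gradedD i h).
by apply: weyl_sub_graded (bracket_D_graded i h).1.
Qed.

Lemma weyl_subM u v : weyl_sub u -> weyl_sub v -> weyl_sub (u * v).
Proof.
move=> hu; move: u hu v; apply: weyl_sub_ind => [m u|u v hu hv w hw]; last first.
  by rewrite mulrDl; apply: weyl_subD; [apply: hu | apply: hv].
elim=> {m u}.
- by move=> m v _; rewrite mul0r; apply: (weyl_sub_graded (m := 0)); constructor.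
- by move=> v; rewrite mul1r.
- by move=> m i u _ IH v hv; rewrite -mulrA; apply/weyl_subMX/IH.
- by move=> m i u _ IH v hv; rewrite -mulrA; apply/IH/weyl_subMD.
- by move=> m u v _ IHu _ IHv w hw; rewrite mulrDl; apply: weyl_subD; [apply: IHu | apply: IHv].
- by move=> m c u _ IH v hv; rewrite -scalerAl; apply/weyl_subZ/IH.
Qed.

Lemma weyl_sub1 : weyl_sub 1.
Proof. by apply: (weyl_sub_graded (m := 0)); constructor. Qed.

Lemma weyl_sub0 : weyl_sub 0.
Proof. by apply: (weyl_sub_graded (m := 0)); constructor. Qed.

Lemma weyl_subX i : weyl_sub (X i).
Proof. by rewrite -[X i]mulr1; apply: weyl_subMX weyl_sub1. Qed.

Lemma weyl_subDer i : weyl_sub (D i).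
Proof. by rewrite -[D i]mulr1; apply: weyl_subMD weyl_sub1. Qed.

Lemma weyl_sub_exp u a : weyl_sub u -> weyl_sub (u ^+ a).
Proof.
move=> h; elim: a => [|a IH]; first by rewrite expr0; apply: weyl_sub1.
by rewrite exprS; apply: weyl_subM.
Qed.

Lemma weyl_sub_in_weyl (N : nat) (c : {ffun 'I_n -> 'I_N} -> {ffun 'I_n -> 'I_N} -> k) :
  weyl_sub (\sum_(a : {ffun 'I_n -> 'I_N}) \sum_(b : {ffun 'I_n -> 'I_N})
          c a b *: weyl_mono X D (fun i => nat_of_ord (a i)) (fun i => nat_of_ord (b i))).
Proof.
apply: (big_ind weyl_sub) => [||a _]; [exact: weyl_sub0 | exact: weyl_subD |].
apply: (big_ind weyl_sub) => [||b _]; [exact: weyl_sub0 | exact: weyl_subD |].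
apply: weyl_subZ; apply: weyl_subM;
  apply: (big_ind weyl_sub) => [||i _]; try exact: weyl_sub1; try exact: weyl_subM.
  exact/weyl_sub_exp/weyl_subX.
exact/weyl_sub_exp/weyl_subDer.
Qed.

Lemma weyl_sub_closure (Q : B -> Prop) :
    Q 1 -> (forall i, Q (X i)) -> (forall i, Q (D i)) ->
    (forall u v, Q u -> Q v -> Q (u + v)) -> (forall u v, Q u -> Q v -> Q (u * v)) ->
    (forall c u, Q u -> Q (c *: u)) ->
  forall u, weyl_sub u -> Q u.
Proof.
move=> Q1 QX QD QA QM QZ; apply: weyl_sub_ind => // m u; elim=> {m u} // *; auto.
by have := QZ 0 _ Q1; rewrite scale0r.
Qed.

End Weyl.

(** * Embeddings of the skew field defined by Weyl relations *)

Section Extension.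
Variables (k : fieldType) (D : unitAlgType k) (n : nat) (x d y e : 'I_n -> D).
Hypothesis ch0 : [pchar k] =i pred0.
Hypothesis divD : is_division_ring D.
Hypothesis WRx : weyl_relations x d.
Hypothesis WF : weyl_fractions x d.
Hypothesis WRy : weyl_relations y e.

(* The subalgebra generated by the pairs (x i, y i) and (d i, e i) is the graph
   of the homomorphism x i |-> y i, d i |-> e i. *)
Let X i : D * D := (x i, y i).
Let Y i : D * D := (d i, e i).

Lemma weyl_relations_pair : weyl_relations X Y.
Proof.
case: WRx => xx dd dx; case: WRy => yy ee ey; split=> i j; apply: injective_projections => /=; auto.
  by rewrite dx; case: (i == j).
by rewrite ey; case: (i == j).
Qed.
Let WR := weyl_relations_pair.
Let graph := weyl_sub X Y.

(** The pairs with first component 0 form an ideal, and a scalar among them vanishes in both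
    components. Simplicity makes the ideal zero, so the graph is single-valued. *)
Lemma graph_fst_inj w : graph w -> w.1 = 0 -> w = 0.
Proof.
move=> [m hw]; apply: (weyl_simple WR (I := fun w => w.1 = 0) ch0) hw => /=.
- by move=> u v -> ->; rewrite addr0.
- by move=> c u ->; rewrite scaler0.
- by move=> u i ->; rewrite mulr0.
- by move=> u i ->; rewrite mul0r.
- by move=> u i ->; rewrite mulr0.
- by move=> u i ->; rewrite mul0r.
- by move=> c /= h; apply: injective_projections.
Qed.

(** The same argument shows that the homomorphism is injective, so that nonzero denominators stay
    nonzero. *)
Lemma graph_snd_inj w : graph w -> w.2 = 0 -> w = 0.
Proof.
move=> [m hw]; apply: (weyl_simple WR (I := fun w => w.2 = 0) ch0) hw => /=.
- by move=> u v -> ->; rewrite addr0.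
- by move=> c u ->; rewrite scaler0.
- by move=> u i ->; rewrite mulr0.
- by move=> u i ->; rewrite mul0r.
- by move=> u i ->; rewrite mulr0.
- by move=> u i ->; rewrite mul0r.
- by move=> c /= h; apply: injective_projections.
Qed.

Lemma graph_total a : in_weyl x d a -> exists2 w, graph w & w.1 = a.
Proof.
move=> [N [c ->]]; eexists; first exact: (weyl_sub_in_weyl WR (N := N) c).
rewrite raddf_sum; apply: eq_bigr => a' _; rewrite raddf_sum; apply: eq_bigr => b _.
rewrite /= /weyl_mono; congr (_ *: _).
rewrite [LHS](rmorphM fst) !rmorph_prod; congr (_ * _); apply: eq_bigr => i _;
  exact: (rmorphXn fst).
Qed.

Lemma graph_snd_neq0 b : graph b -> b.1 != 0 -> b.2 != 0.
Proof. by move=> hb; apply: contraNneq => /(graph_snd_inj hb) ->. Qed.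

Lemma graphB u v : graph u -> graph v -> graph (u - v).
Proof. by move=> hu hv; rewrite -scaleN1r; apply: weyl_subD => //; apply: weyl_subZ. Qed.

(** The Ore condition: write [b.1^-1 * c.1] as a right fraction [u.1 / v.1]; the identity of first
    components lifts to pairs by [graph_fst_inj]. *)
Lemma graph_ore b c : graph b -> graph c -> b.1 != 0 ->
  exists u v, [/\ graph u, graph v, v.1 != 0 & b * u = c * v].
Proof.
move=> hb hc b0; have [a' [b' [/graph_total[u hu <-] /graph_total[v hv <-] v0 E]]] := WF
  (b.1^-1 * c.1).
exists u, v; split=> //; apply/eqP; rewrite -subr_eq0; apply/eqP; apply: graph_fst_inj.
  by apply: graphB; apply: (weyl_subM WR).
have -> : (b * u - c * v).1 = b.1 * u.1 - c.1 * v.1 by [].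
have -> : c.1 = b.1 * (u.1 / v.1) by rewrite -E mulVKr ?divD.
by rewrite -mulrA divrK ?divD // subrr.
Qed.

Definition frac_graph q p := exists a b,
  [/\ graph a, graph b, b.1 != 0, q = a.1 / b.1 & p = a.2 / b.2].

Lemma frac_graph_of_graph w : graph w -> frac_graph w.1 w.2.
Proof. by move=> hw; exists w, 1; split=> //; rewrite ?oner_eq0 ?divr1 //; apply: weyl_sub1. Qed.

Lemma frac_graph_total q : exists p, frac_graph q p.
Proof.
have [a' [b' [/graph_total[a ha <-] /graph_total[b hb <-] b0 ->]]] := WF q.
by exists (a.2 / b.2), a, b.
Qed.

Lemma frac_graphZ c q p : frac_graph q p -> frac_graph (c *: q) (c *: p).
Proof.
move=> [a [b [ha hb b0 -> ->]]]; exists (c *: a), b; split=> //; last 2 first.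
- by rewrite scalerAl.
- by rewrite scalerAl.
exact: weyl_subZ.
Qed.

Lemma mulr_neq0_div (u v : D) : u != 0 -> v != 0 -> u * v != 0.
Proof.
by move=> /divD u0; apply: contraNneq => uv0; rewrite -[v](mulKr u0) uv0 mulr0.
Qed.

Lemma invM_div (u v : D) : u != 0 -> v != 0 -> (u * v)^-1 = v^-1 * u^-1.
Proof. by move=> u0 v0; rewrite invrM ?divD. Qed.

Lemma div_expand (a b v : D) : b != 0 -> v != 0 -> a / b = (a * v) / (b * v).
Proof. by move=> b0 v0; rewrite invM_div // mulrA mulrK ?divD. Qed.

(** [graph_ore] gives a common denominator [b * u = b' * v], valid in both components at once. *)
Lemma frac_graphD q p q' p' :
  frac_graph q p -> frac_graph q' p' -> frac_graph (q + q') (p + p').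
Proof.
move=> [a [b [ha hb b0 -> ->]]] [a' [b' [ha' hb' b'0 -> ->]]].
have [u [v [hu hv v0 E]]] := graph_ore hb hb' b0.
have [E1 E2] : b.1 * u.1 = b'.1 * v.1 /\ b.2 * u.2 = b'.2 * v.2 by case: E.
have u0 : u.1 != 0.
  by have := mulr_neq0_div b'0 v0; rewrite -E1; apply: contraNneq => ->; rewrite mulr0.
have [b2 b'2 u2 v2] := And4 (graph_snd_neq0 hb b0) (graph_snd_neq0 hb' b'0)
  (graph_snd_neq0 hu u0) (graph_snd_neq0 hv v0).
exists (a * u + a' * v), (b * u); split.
- by apply: weyl_subD; apply: (weyl_subM WR).
- exact: (weyl_subM WR).
- exact: mulr_neq0_div.
- by rewrite (div_expand a.1 b0 u0) (div_expand a'.1 b'0 v0) -E1 -mulrDl.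
- by rewrite (div_expand a.2 b2 u2) (div_expand a'.2 b'2 v2) -E2 -mulrDl.
Qed.

Lemma frac_graphM q p q' p' :
  frac_graph q p -> frac_graph q' p' -> frac_graph (q * q') (p * p').
Proof.
move=> [a [b [ha hb b0 -> ->]]] [a' [b' [ha' hb' b'0 -> ->]]].
have [u [v [hu hv v0 E]]] := graph_ore hb ha' b0.
have [E1 E2] : b.1 * u.1 = a'.1 * v.1 /\ b.2 * u.2 = a'.2 * v.2 by case: E.
have [b2 b'2 v2] := And3 (graph_snd_neq0 hb b0) (graph_snd_neq0 hb' b'0) (graph_snd_neq0 hv v0).
exists (a * u), (b' * v); split.
- exact: (weyl_subM WR).
- exact: (weyl_subM WR).
- exact: mulr_neq0_div.
- by rewrite (div_expand a'.1 b'0 v0) -E1 !mulrA divrK ?divD.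
- by rewrite (div_expand a'.2 b'2 v2) -E2 !mulrA divrK ?divD.
Qed.

(** By difference, [p - p'] is related to 0, and a numerator with first component 0 vanishes. *)
Lemma frac_graph_inj q p p' : frac_graph q p -> frac_graph q p' -> p = p'.
Proof.
move=> h /(frac_graphZ (-1)) /(frac_graphD h); rewrite !scaleN1r subrr.
move=> [a [b [ha hb b0 Ea Ep]]]; apply/eqP; rewrite -subr_eq0 Ep.
have a0 : a.1 = 0 by rewrite -[a.1](divrK (divD b0)) -Ea mul0r.
by rewrite (graph_fst_inj ha a0) mul0r.
Qed.

(** The function is picked by choice; single-valuedness of [frac_graph] gives each law. *)
Lemma weyl_hom_exists : exists f : D -> D,
  [/\ is_alg_hom f, forall i, f (x i) = y i & forall i, f (d i) = e i].
Proof.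
have [f fP] := boolp.choice frac_graph_total.
have fE q p : frac_graph q p -> f q = p by apply: frac_graph_inj (fP q).
exists f; split; last 2 first.
- by move=> i; apply: fE; apply: (@frac_graph_of_graph (X i)); apply: weyl_subX.
- by move=> i; apply: fE; apply: (@frac_graph_of_graph (Y i)); apply: (weyl_subDer WR).
split.
- by apply: fE; apply: (@frac_graph_of_graph 1); apply: weyl_sub1.
- by move=> u v; apply: fE; apply: frac_graphD.
- by move=> u v; apply: fE; apply: frac_graphM.
- by move=> c u; apply: fE; apply: frac_graphZ.
Qed.

End Extension.

(** * Lagrange interpolation at commuting elements of a division ring *)

(** In a noncommutative ring a factor is extracted by commutation: [F i] is spread out as a product
    of ones and [F i], then multiplied in termwise. *)
Lemma prod_commD1 (R : pzRingType) (I : finType) (P : pred I) (F : I -> R) (i : I) :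
    (forall j l, GRing.comm (F j) (F l)) -> P i ->
  \prod_(j | P j) F j = (\prod_(j | P j && (j != i)) F j) * F i.
Proof.
move=> FC Pi; have -> : F i = \prod_(j | P j) (if j == i then F j else 1).
  rewrite -big_mkcondr (big_pred1 i) // => j /=.
  by rewrite andbC; case: eqP => // ->.
rewrite big_mkcondr -prodrM_comm => [|j l _ _].
  by apply: eq_bigr => j _; case: eqP; rewrite ?mul1r ?mulr1.
by case: (j != i); case: (l == i) => //; apply: commr_sym; apply: commr1 || apply: commr_sym;
  apply: commr1.
Qed.

Section Lagrange.
Variables (D : unitRingType) (n : nat) (x : 'I_n -> D).
Hypothesis xC : forall i j, GRing.comm (x i) (x j).
Hypothesis xU : forall i j, i != j -> x i - x j \is a GRing.unit.

Definition lagrange_num (m : 'I_n) : {poly D} := \prod_(i | i != m) ('X - (x i)%:P).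
Definition lagrange_den m := (lagrange_num m).[x m].
Definition vieta_poly : {poly D} := \prod_i ('X - (x i)%:P).
(** Differentiating P(x_m) = 0 shows that this is the partial derivative of x_m in the coordinate
    y_l, [lagrange_den m] being P'(x_m). *)
Definition dual_coef (l : nat) m := x m ^+ l * (lagrange_den m)^-1.

Lemma comm_polyC_XsubC (u a : D) : GRing.comm u a -> GRing.comm u%:P ('X - a%:P).
Proof.
move=> ua; apply: commrB; first exact: commr_polyX.
by rewrite /GRing.comm -!polyCM ua.
Qed.

Lemma comm_XsubC i j : GRing.comm ('X - (x i)%:P) ('X - (x j)%:P).
Proof.
apply: commr_sym; apply: commrB; first exact: commr_polyX.
apply: commr_sym; apply: comm_polyC_XsubC; exact: xC.
Qed.

Lemma vieta_poly_factor m : vieta_poly = lagrange_num m * ('X - (x m)%:P).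
Proof. by rewrite /vieta_poly (prod_commD1 (i := m)) //; apply: comm_XsubC. Qed.

Lemma comm_coef_prod (r : seq 'I_n) (P : pred 'I_n) (u : D) l :
  (forall i, GRing.comm u (x i)) -> GRing.comm u (\prod_(i <- r | P i) ('X - (x i)%:P))`_l.
Proof.
move=> ux; have /(congr1 (coefp l)) : GRing.comm u%:P (\prod_(i <- r | P i) ('X - (x i)%:P)).
  by apply: commr_prod => i _; apply/comm_polyC_XsubC/ux.
by rewrite /= coefCM coefMC.
Qed.

Lemma horner_prod_XsubC_comm (r : seq 'I_n) (P : pred 'I_n) (z : D) :
  (forall i, GRing.comm z (x i)) ->
  (\prod_(i <- r | P i) ('X - (x i)%:P)).[z] = \prod_(i <- r | P i) (z - x i).
Proof.
move=> zx; elim: r => [|i r IH]; first by rewrite !big_nil hornerC.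
rewrite !big_cons; case: ifP => // _; rewrite hornerM_comm ?hornerXsubC ?IH //.
by apply: comm_coef_poly => l; apply/commr_sym/comm_coef_prod.
Qed.

Lemma comm_lagrange_den m (u : D) :
  (forall i, GRing.comm u (x i)) -> GRing.comm u (lagrange_den m).
Proof.
move=> ux; apply: commr_horner; first exact: ux.
by move=> l; apply: commr_sym; apply: comm_coef_prod.
Qed.

Lemma comm_dual_coef l m (u : D) :
  (forall i, GRing.comm u (x i)) -> GRing.comm u (dual_coef l m).
Proof.
by move=> ux; apply: commrM; [apply: commrX | apply: commrV; apply: comm_lagrange_den].
Qed.

Lemma lagrange_num_root i m : i != m -> (lagrange_num m).[x i] = 0.
Proof.
move=> im; rewrite /lagrange_num (prod_commD1 (i := i)) //; last exact: comm_XsubC.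
by rewrite hornerM_comm ?hornerXsubC ?subrr ?mulr0 // /comm_poly hornerXsubC subrr mulr0 mul0r.
Qed.

Lemma lagrange_denE m : lagrange_den m = \prod_(i | i != m) (x m - x i).
Proof. by rewrite /lagrange_den /lagrange_num horner_prod_XsubC_comm. Qed.

Lemma lagrange_den_unit m : lagrange_den m \is a GRing.unit.
Proof.
by rewrite lagrange_denE; apply: rpred_prod => i im; apply: xU; rewrite eq_sym.
Qed.

Lemma size_lagrange_num m : (size (lagrange_num m) <= n)%N.
Proof.
rewrite /lagrange_num -big_filter size_prod_XsubC size_filter -sum1_count.
by rewrite sum1_card cardC1 card_ord prednK // (leq_ltn_trans _ (ltn_ord m)).
Qed.

(** [uniq_roots] asks for commuting roots with invertible differences; this bounds the number of
    roots over a noncommutative ring. *)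
Lemma uniq_roots_codom : uniq_roots (codom x).
Proof.
rewrite /codom /image_mem; elim: (enum 'I_n) (enum_uniq 'I_n) => //= i r IH /andP[ir ur].
rewrite IH // andbT; apply/allP => _ /mapP[j jr ->]; rewrite /diff_roots xC eqxx /= xU //.
by apply: contraNneq ir => <-.
Qed.

(** Lagrange interpolation of ['X^l] at the x_m: the error [Q] has size at most [n] and [n] roots,
    hence is zero; compare coefficients. *)
Lemma dual_coef_interp l (r : nat) : (l < n)%N ->
  \sum_m dual_coef l m * (lagrange_num m)`_r = (r == l)%:R.
Proof.
move=> ln; pose Q := \sum_m (dual_coef l m)%:P * lagrange_num m - 'X^l.
suff Q0 : Q = 0.
  have /(congr1 (coefp r)) /eqP := Q0.
  rewrite /= /Q coefB coefXn coef0 subr_eq0 => /eqP <-.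
  by rewrite coef_sum; apply: eq_bigr => m _; rewrite coefCM.
have sQ : (size Q <= n)%N.
  rewrite (leq_trans (size_polyD _ _)) // size_polyN size_polyXn geq_max ln andbT.
  apply: leq_trans (size_sum _ _ _) _; apply/bigmax_leqP => m _.
  by rewrite mul_polyC (leq_trans (size_scale_leq _ _)) ?size_lagrange_num.
apply/eqP; apply: contraTT sQ => Q0; rewrite -ltnNge.
have <- : size (codom x) = n by rewrite size_codom card_ord.
apply: max_ring_poly_roots => //; last exact: uniq_roots_codom.
apply/allP => _ /codomP[i ->]; rewrite rootE /Q hornerD hornerN hornerXn horner_sum (bigD1 i) //=.
rewrite hornerCM /dual_coef divrK ?lagrange_den_unit // big1 ?addr0 ?subrr // => m mi.
by rewrite hornerCM lagrange_num_root ?mulr0 // eq_sym.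
Qed.

(** The product of the same two matrices in the other order, found by evaluating [lagrange_num i] at
    x_m. *)
Lemma lagrange_num_dual i m :
  \sum_(l < n) (lagrange_num i)`_l * dual_coef l m = (i == m)%:R.
Proof.
under eq_bigr do rewrite /dual_coef mulrA.
rewrite -mulr_suml -horner_coef_wide ?size_lagrange_num //.
case: eqVneq => [->|im]; first by rewrite divrr ?lagrange_den_unit.
by rewrite lagrange_num_root ?mul0r // eq_sym.
Qed.

End Lagrange.

(** * Elementary symmetric coordinates and their vector fields *)

Section ElementaryCoordinates.
Variables (k : fieldType) (D : unitAlgType k) (n : nat) (x d : 'I_n -> D).
Hypothesis divD : is_division_ring D.
Hypothesis WR : weyl_relations x d.

Lemma weyl_xC i j : GRing.comm (x i) (x j).
Proof. by case: WR. Qed.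

Lemma weyl_dx i j : bracket (d i) (x j) = (i == j)%:R.
Proof. by case: WR => _ _ h; rewrite bracketE. Qed.

(** If x_i = x_j, bracketing with [d i] gives 1 = 0. *)
Lemma weyl_xU i j : i != j -> x i - x j \is a GRing.unit.
Proof.
move=> ij; apply: divD; apply: contraNneq (oner_neq0 D) => h.
have := congr1 (bracket (d i)) h; rewrite bracketDr [bracket _ (- _)]bracketC bracketNl -bracketC.
by rewrite !weyl_dx eqxx (negPf ij) subr0 bracket0r => /eqP.
Qed.

Let xC := weyl_xC.
Let xU := weyl_xU.

(* Up to sign, the elementary symmetric functions of the [x i]. *)
Definition elsym (l : 'I_n) : D := - (vieta_poly x)`_l.
(** The field d/dy_l, by the chain rule. *)
Definition elsym_der (l : 'I_n) : D := \sum_m dual_coef x l m * d m.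

Lemma bracket_coef (u : D) (p : {poly D}) l : (bracket u%:P p)`_l = bracket u p`_l.
Proof. by rewrite !bracketE coefB coefCM coefMC. Qed.

(** [d m] commutes with every factor of the Vieta polynomial except ['X - (x m)%:P], which it sends
    to -1; the sign in [elsym] cancels this one. *)
Lemma bracket_d_elsym m l : bracket (d m) (elsym l) = (lagrange_num x m)`_l.
Proof.
rewrite /elsym bracketC bracketNl -bracketC -bracket_coef (vieta_poly_factor xC m) bracketMr.
have /bracket_eq0 -> : GRing.comm (d m)%:P (lagrange_num x m).
  apply: commr_prod => i im; apply: comm_polyC_XsubC; apply/bracket_eq0.
  by rewrite weyl_dx eq_sym (negPf im).
rewrite mul0r add0r.
have -> : bracket (d m)%:P ('X - (x m)%:P) = -1.
  rewrite bracketDr [bracket _ (- _)]bracketC bracketNl -bracketC.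
  have /bracket_eq0 -> := commr_polyX (d m)%:P.
  by rewrite bracketE -!polyCM -polyCB -bracketE weyl_dx eqxx add0r.
by rewrite mulrN1 coefN opprK.
Qed.

Lemma comm_elsym l u : (forall i, GRing.comm u (x i)) -> GRing.comm u (elsym l).
Proof. by move=> ux; apply/commrN/comm_coef_prod. Qed.

Lemma comm_x_dual l m i : GRing.comm (x i) (dual_coef x l m).
Proof. by apply: comm_dual_coef => j; apply: xC. Qed.

Lemma bracket_der_elsym (g : 'I_n -> D) r : (forall m i, GRing.comm (g m) (x i)) ->
  bracket (\sum_m g m * d m) (elsym r) = \sum_m g m * (lagrange_num x m)`_r.
Proof.
move=> gx; rewrite bracket_suml; apply: eq_bigr => m _; rewrite bracketMl bracket_d_elsym.
by have /bracket_eq0 -> := comm_elsym r (gx m); rewrite mul0r addr0.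
Qed.

Lemma bracket_elsym_der_elsym l r : bracket (elsym_der l) (elsym r) = (l == r)%:R.
Proof.
rewrite bracket_der_elsym; last by move=> m i; apply/commr_sym/comm_x_dual.
by rewrite dual_coef_interp // -val_eqE /= eq_sym.
Qed.

(* The Jacobian matrix of [elsym] is invertible, so a vector field is determined
   by its values on [elsym]. *)
Lemma der_eq0 (g : 'I_n -> D) : (forall m i, GRing.comm (g m) (x i)) ->
  (forall r, bracket (\sum_m g m * d m) (elsym r) = 0) -> \sum_m g m * d m = 0.
Proof.
move=> gx g0; apply: big1 => m _.
suff -> : g m = 0 by rewrite mul0r.
transitivity (\sum_i g i * (i == m)%:R).
  by rewrite (bigD1 m) //= eqxx mulr1 big1 ?addr0 // => i /negPf ->; rewrite mulr0.
under eq_bigr do rewrite -(lagrange_num_dual xC xU) mulr_sumr.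
rewrite exchange_big big1 //= => r _; under eq_bigr do rewrite mulrA.
by rewrite -mulr_suml -(bracket_der_elsym r gx) g0 mul0r.
Qed.

Lemma bracket_elsym_der_x l i : bracket (elsym_der l) (x i) = dual_coef x l i.
Proof.
rewrite bracket_suml (bigD1 i) //= big1 ?addr0 => [|m mi]; rewrite bracketMl weyl_dx.
  have /bracket_eq0 -> := commr_sym (comm_x_dual l i i).
  by rewrite eqxx mulr1 mul0r addr0.
have /bracket_eq0 -> := commr_sym (comm_x_dual l m i).
by rewrite (negPf mi) mulr0 mul0r addr0.
Qed.

(** The commutator of two vector fields is a vector field. It kills every [elsym], where both fields
    take constant values, so [der_eq0] applies. *)
Lemma elsym_derC l r : GRing.comm (elsym_der l) (elsym_der r).
Proof.
apply/bracket_eq0; have dd i j : bracket (d i) (d j) = 0 by case: WR => _ h _; apply/bracket_eq0/h.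
pose c (l : 'I_n) m := dual_coef x l m.
have cc l1 m1 l2 m2 : bracket (c l1 m1) (c l2 m2) = 0.
  by apply/bracket_eq0; apply: comm_dual_coef => i; apply/commr_sym/comm_x_dual.
have E : bracket (elsym_der l) (elsym_der r) =
    \sum_m (bracket (elsym_der l) (c r m) - bracket (elsym_der r) (c l m)) * d m.
  rewrite {2}/elsym_der bracket_sumr; under eq_bigr do rewrite bracketMr.
  rewrite big_split /=; under [RHS]eq_bigr do rewrite mulrDl mulNr.
  rewrite big_split /=; congr (_ + _).
  under eq_bigr => m _ do rewrite {1}/elsym_der bracket_suml mulr_sumr.
  rewrite exchange_big /=; apply: eq_bigr => m _.
  rewrite -mulNr -bracketC /elsym_der bracket_sumr mulr_suml.
  apply: eq_bigr => j _; rewrite bracketMl bracketMr dd cc.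
  by rewrite mulr0 add0r mul0r add0r mulrA.
(* By the Jacobi identity the coefficients of the commutator again commute with the x_i. *)
have bc l1 l2 m i : bracket (bracket (elsym_der l1) (c l2 m)) (x i) = 0.
  rewrite bracket_jacobi bracket_elsym_der_x cc subr0.
  by have /bracket_eq0 -> := commr_sym (comm_x_dual l2 m i); rewrite bracket0r.
rewrite E; apply: der_eq0 => [m i|s].
  by apply/bracket_eq0; rewrite bracketDl bracketNl !bc subrr.
rewrite -E bracket_jacobi !bracket_elsym_der_elsym.
have b1 u (b : bool) : bracket u (b%:R : D) = 0.
  by apply/bracket_eq0; case: b; [apply: commr1 | apply: commr0].
by rewrite !b1 subrr.
Qed.

Lemma weyl_relations_elsym : weyl_relations elsym elsym_der.
Proof.
split=> [i j|i j|i j]; [|exact: elsym_derC|by rewrite -bracketE bracket_elsym_der_elsym].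
by apply: comm_elsym => m; apply/commr_sym/comm_elsym => m'; apply: xC.
Qed.

(** The chain rule backwards: the coefficients of [lagrange_num x i] are the derivatives of the y_l
    in x_i. *)
Lemma d_elsym_der i : d i = \sum_(l < n) (lagrange_num x i)`_l * elsym_der l.
Proof.
under eq_bigr do rewrite mulr_sumr; rewrite exchange_big /=.
under eq_bigr do under eq_bigr do rewrite mulrA.
under eq_bigr do rewrite -mulr_suml (lagrange_num_dual xC xU).
by rewrite (bigD1 i) //= eqxx mul1r big1 ?addr0 // => m; rewrite eq_sym => /negPf ->; rewrite mul0r.
Qed.

Lemma vieta_poly_root i : x i ^+ n = \sum_(l < n) elsym l * x i ^+ l.
Proof.
have size_v : size (vieta_poly x) = n.+1.
  by rewrite /vieta_poly size_prod_XsubC /index_enum -enumT size_enum_ord.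
have : root (vieta_poly x) (x i).
  by apply/factor_theorem; exists (lagrange_num x i); apply: vieta_poly_factor.
rewrite rootE => /eqP.
rewrite (horner_coef_wide (n := n.+1)) ?size_v // big_ord_recr /=.
have /monicP : vieta_poly x \is monic by apply: monic_prod_XsubC.
rewrite /lead_coef size_v /= => ->; rewrite mul1r addrC => /eqP; rewrite addr_eq0 => /eqP ->.
by rewrite -sumrN; apply: eq_bigr => l _; rewrite mulNr.
Qed.

End ElementaryCoordinates.

(** * Finite-dimensional spaces over a division subalgebra *)

Definition division_subalg (k : fieldType) (D : unitAlgType k) (E : D -> Prop) :=
  [/\ E 1, forall u v, E u -> E v -> E (u + v), forall u v, E u -> E v -> E (u * v),
      forall u, E u -> E u^-1 & forall (c : k) u, E u -> E (c *: u)].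

Section DivisionSubalgebra.
Variables (k : fieldType) (D : unitAlgType k) (E : D -> Prop).
Hypothesis divD : is_division_ring D.
Hypothesis EP : division_subalg E.

Let E1 : E 1. Proof. by case: EP. Qed.
Let ED u v : E u -> E v -> E (u + v). Proof. by case: EP => _ h _ _ _; apply: h. Qed.
Let EM u v : E u -> E v -> E (u * v). Proof. by case: EP => _ _ h _ _; apply: h. Qed.
Let EV u : E u -> E u^-1. Proof. by case: EP => _ _ _ h _; apply: h. Qed.
Let EZ c u : E u -> E (c *: u). Proof. by case: EP => _ _ _ _ h; apply: h. Qed.

Lemma division_subalg0 : E 0.
Proof. by rewrite -(scale0r 1); apply: EZ. Qed.

Lemma division_subalgN u : E u -> E (- u).
Proof. by rewrite -scaleN1r; apply: EZ. Qed.

Lemma division_subalg_sum (I : Type) (r : seq I) (P : pred I) (F : I -> D) :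
  (forall i, P i -> E (F i)) -> E (\sum_(i <- r | P i) F i).
Proof. by apply: big_ind; [exact: division_subalg0 | exact: ED]. Qed.

Lemma division_subalg_prod (I : Type) (r : seq I) (P : pred I) (F : I -> D) :
  (forall i, P i -> E (F i)) -> E (\prod_(i <- r | P i) F i).
Proof. by apply: big_ind; [exact: E1 | exact: EM]. Qed.

Lemma division_subalg_exp u m : E u -> E (u ^+ m).
Proof. by move=> Eu; elim: m => [|m IH]; rewrite ?expr0 // exprS; apply: EM. Qed.

(** Gaussian elimination with the unknowns on the right. Indexing the solution by [nat] lets it be
    shifted later. *)
Lemma linear_system_nontrivial m (M : 'I_m -> nat -> D) : (forall i j, E (M i j)) ->
  exists c : nat -> D, [/\ forall j, E (c j), exists j : 'I_m.+1, c j != 0 &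
    forall i, \sum_(j < m.+1) M i j * c j = 0].
Proof.
elim: m M => [|m IH] M EMij.
  exists (fun=> 1); split; [by []| by exists ord0; rewrite oner_neq0 | by case].
have [/existsP[j0 p0] | /existsPn z] := boolP [exists j : 'I_m.+2, M ord0 j != 0]; last first.
  have [c [Ec [j cj] cM]] := IH (fun i => M (lift ord0 i)) (fun i => EMij (lift ord0 i)).
  (* The first equation is void: the others are solved in the first [m.+1] unknowns, and the last
     unknown is set to 0. *)
  exists (fun j => if (j < m.+1)%N then c j else 0); split.
  - by move=> i; case: ifP => // _; apply: division_subalg0.
  - by exists (widen_ord (leqnSn _) j); rewrite /= ltn_ord.
  move=> i; case: (unliftP ord0 i) => [i'|] ->; last first.
    by apply: big1 => j' _; have := z j'; rewrite negbK => /eqP ->; rewrite mul0r.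
  rewrite big_ord_recr /= ltnn mulr0 addr0 -[RHS](cM i'); apply: eq_bigr => j' _.
  by rewrite ltn_ord.
pose p := M ord0 j0.
(* Eliminate the unknown [j0] with pivot [p]; [bump j0] numbers the remaining ones, and [c0] then
   solves the first equation. *)
pose b j := bump j0 j.
pose M' i j := M (lift ord0 i) (b j) - M (lift ord0 i) j0 * p^-1 * M ord0 (b j).
have EM' i j : E (M' i j).
  apply: ED; first exact: EMij.
  apply/division_subalgN/EM; last exact: EMij.
  by apply: EM; [|apply: EV]; apply: EMij.
have [c [Ec [j1 cj1] cM]] := IH M' EM'.
have nb j : (bump j0 j == j0 :> nat) = false by rewrite eq_sym (negPf (neq_bump _ _)).
pose c0 := - (p^-1 * \sum_(j < m.+1) M ord0 (b j) * c j).
have Ec0 : E c0.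
  apply: division_subalgN; apply: EM; first by apply: EV; apply: EMij.
  by apply: division_subalg_sum => j _; apply: EM; first apply: EMij.
exists (fun j : nat => if j == j0 :> nat then c0 else c (unbump j0 j)); split.
- by move=> j; case: eqP.
- by exists (lift j0 j1); rewrite /= nb bumpK.
have S i : \sum_(j < m.+2) M i j * (if j == j0 :> nat then c0 else c (unbump j0 j)) =
    M i j0 * c0 + \sum_(j < m.+1) M i (b j) * c j.
  rewrite (bigD1_ord j0) //= eqxx; congr (_ + _); apply: eq_bigr => j _.
  by rewrite /= nb bumpK.
move=> i; rewrite S; case: (unliftP ord0 i) => [i'|] ->.
  rewrite -[RHS](cM i') /M' /c0; under [RHS]eq_bigr do rewrite mulrBl.
  rewrite sumrB addrC mulrN mulrA mulr_sumr; congr (_ - _).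
  by apply: eq_bigr => j _; rewrite !mulrA.
by rewrite /c0 mulrN mulVKr ?divD // addrC subrr.
Qed.

(* Injective endomorphisms of a finite-dimensional space are onto. *)
Lemma left_inverse_stable (I : finType) (G : I -> D) (V : D -> Prop) (b v : D) :
    (forall u w, V u -> V w -> V (u + w)) -> (forall u a, V u -> E a -> V (u * a)) ->
    (forall u, V u -> exists2 a : I -> D, forall i, E (a i) & u = \sum_i G i * a i) ->
    (forall u, V u -> V (b * u)) -> b != 0 ->
  V v -> V (b^-1 * v).
Proof.
move=> VD VE VG Vb b0 Vv.
have Vbv j : V (b ^+ j * v).
  by elim: j => [|j IH]; rewrite ?expr0 ?mul1r // exprS -mulrA; apply: Vb.
have eX j : exists a : I -> D, (forall i, E (a i)) /\ b ^+ j * v = \sum_i G i * a i.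
  by have [a] := VG _ (Vbv j); exists a.
have [e eP] := boolp.choice eX.
(* The [#|I|.+1] vectors [b ^+ j * v] have [#|I|] coordinates each, hence are dependent over [E]. *)
have [c [Ec [j1 cj1] cM]] :=
  linear_system_nontrivial (M := fun (i : 'I_#|I|) j => e j (enum_val i)) (fun i j => (eP j).1 _).
have : \sum_(j < #|I|.+1) b ^+ j * v * c j = 0.
  under eq_bigr => j _ do rewrite (eP j).2 mulr_suml.
  rewrite exchange_big big1 //= => i _; under eq_bigr do rewrite -mulrA.
  by have := cM (enum_rank i); rewrite -mulr_sumr enum_rankK => ->; rewrite mulr0.
have {j1 cj1} : exists2 j, (j < #|I|.+1)%N & c j != 0 by exists j1.
(* Shorten the relation: if its constant coefficient is 0, cancel [b] on the left; otherwise it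
   expresses [v] as [b] times an element of [V]. *)
move: (#|I|.+1) => m {cM eP e}; elim: m c Ec => [c _ [] //|m IH c Ec [j jm cj]].
have VS : V (\sum_(j < m) b ^+ j * v * c j.+1).
  apply: (big_ind V) => [||i _]; [|exact: VD | exact: VE].
  by rewrite -(mulr0 v); apply: VE => //; apply: division_subalg0.
rewrite big_ord_recl expr0 mul1r /=.
have -> : \sum_(i < m) b ^+ bump 0 i * v * c (bump 0 i) = b * \sum_(j < m) b ^+ j * v * c j.+1.
  by rewrite mulr_sumr; apply: eq_bigr => i _; rewrite exprS !mulrA.
have [c00 | c00] := eqVneq (c 0%N) 0.
  rewrite c00 mulr0 add0r => S0; apply: (IH (fun j => c j.+1)) => [i||]; first exact: Ec.
    by case: j jm cj => [|j] jm; [rewrite c00 eqxx | exists j].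
  by rewrite -[LHS](mulKr (divD b0)) S0 mulr0.
move/eqP; rewrite addr_eq0 => /eqP S0.
rewrite -[v](mulrK (divD c00)) S0 mulNr mulrN -!mulrA mulKr ?divD // -mulrN.
by apply: VE => //; apply/division_subalgN/EV.
Qed.

End DivisionSubalgebra.

(** * The monomials in x span D over E *)

Section Spanning.
Variables (k : fieldType) (D : unitAlgType k) (n' : nat).
Let n := n'.+1.
Variables (x d : 'I_n -> D) (E : D -> Prop).
Hypothesis divD : is_division_ring D.
Hypothesis WR : weyl_relations x d.
Hypothesis WF : weyl_fractions x d.
Hypothesis EP : division_subalg E.
Hypothesis Eelsym : forall l, E (elsym x l).
Hypothesis Eder : forall l, E (elsym_der x d l).

Let xC : forall i j, GRing.comm (x i) (x j) := weyl_xC WR.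
Let E0 := division_subalg0 EP.
Let E1 : E 1. Proof. by case: EP. Qed.
Let ED u v : E u -> E v -> E (u + v). Proof. by case: EP => _ h _ _ _; apply: h. Qed.
Let EM u v : E u -> E v -> E (u * v). Proof. by case: EP => _ _ h _ _; apply: h. Qed.

Definition xmono (a : 'I_n -> nat) : D := \prod_i x i ^+ a i.

Lemma xmono_mul i a : x i * xmono a = xmono (fun j => (j == i) + a j)%N.
Proof.
rewrite /xmono; under [RHS]eq_bigr do rewrite exprD.
rewrite prodrM_comm => [|j l _ _]; last by apply/commrX/commr_sym/commrX.
congr (_ * _); rewrite (eq_bigr (fun j => if j == i then x j else 1)) => [|j _].
  by rewrite -big_mkcond big_pred1_eq.
by case: eqP.
Qed.

Lemma xmono_exp0 : xmono (fun=> 0%N) = 1.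
Proof. by rewrite /xmono big1. Qed.

Inductive xspan : D -> Prop :=
| xspan_mono a e : E e -> xspan (xmono a * e)
| xspanD u v : xspan u -> xspan v -> xspan (u + v).

Lemma xspan_E e : E e -> xspan e.
Proof. by move=> Ee; rewrite -[e]mul1r -xmono_exp0; apply: xspan_mono. Qed.

Lemma xspan_x i u : xspan u -> xspan (x i * u).
Proof.
elim=> {u} [a e Ee|u v _ IHu _ IHv]; last by rewrite mulrDr; apply: xspanD.
by rewrite mulrA xmono_mul; apply: xspan_mono.
Qed.

(** Peels off one letter x_i at a time, so that the Leibniz rule can be applied to monomials. *)
Lemma xspan_ind_x (Q : D -> Prop) :
    (forall e, E e -> Q e) -> (forall i u, xspan u -> Q u -> Q (x i * u)) ->
    (forall u v, Q u -> Q v -> Q (u + v)) ->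
  forall u, xspan u -> Q u.
Proof.
move=> QE Qx QD u; elim=> {u} [a e Ee|u v _ IHu _ IHv]; last exact: QD.
suff /(_ (index_enum _)) [] : forall r : seq 'I_n,
  xspan (\prod_(i <- r) x i ^+ a i * e) /\ Q (\prod_(i <- r) x i ^+ a i * e) by [].
elim=> [|i r [IHs IHQ]]; first by rewrite big_nil mul1r; split; [apply: xspan_E | apply: QE].
rewrite big_cons; elim: (a i) => [|j [IHs' IHQ']]; first by rewrite expr0 mul1r.
by rewrite exprS -!mulrA in IHs' IHQ' *; split; [apply: xspan_x | apply: Qx].
Qed.

Lemma xspan_Mr u e : xspan u -> E e -> xspan (u * e).
Proof.
move=> hu Ee; elim: hu => {u} [a e' Ee'|u v _ IHu _ IHv].
  by rewrite -mulrA; apply/xspan_mono/EM.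
by rewrite mulrDl; apply: xspanD.
Qed.

(** [E] contains derivations, which do not commute with the x_i. The coefficients met in reducing
    powers do, and can be collected on the right. *)
Definition subalg_commx u := E u /\ forall i, GRing.comm u (x i).

Lemma x_exp_reduce i r :
  exists c : 'I_n -> D, (forall l, subalg_commx (c l)) /\ x i ^+ r = \sum_(l < n) x i ^+ l * c l.
Proof.
elim: r => [|r [c [Ec IH]]].
  exists (fun l => (l == ord0)%:R); split.
    by move=> l; case: eqP => _; split=> // j; [apply/commr_sym/commr1 | apply/commr_sym/commr0].
  rewrite big_ord_recl eqxx mulr1 big1 ?addr0 // => l _.
  by rewrite mulr0.
(* Multiplying by x_i shifts the coefficients by one, leaving 0 in degree 0; the top one meets
   x_i^n, which [vieta_poly_root] replaces. *)
pose c1 l := if unlift ord0 l is Some j then c (widen_ord (leqnSn n') j) else 0.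
exists (fun l => c1 l + elsym x l * c ord_max); split.
  move=> l; have [El cl] := Ec ord_max; split.
    apply: ED; last exact: EM.
    by rewrite /c1; case: (unlift _ _) => [j|//]; case: (Ec (widen_ord (leqnSn n') j)).
  move=> j; apply: commr_sym; apply: commrD.
    rewrite /c1; case: (unlift _ _) => [j'|]; last exact: commr0.
    by case: (Ec (widen_ord (leqnSn n') j')) => _ /(_ j) /commr_sym.
  by apply: commrM; [apply: comm_elsym => j'; apply: xC | apply: commr_sym].
under eq_bigr do rewrite mulrDr; rewrite big_split /=.
rewrite exprS IH big_ord_recr /= mulrDr mulrA -exprS (vieta_poly_root WR i) mulr_suml mulr_sumr.
congr (_ + _).
  rewrite big_ord_recl /c1 unlift_none mulr0 add0r; apply: eq_bigr => l _.
  by rewrite liftK mulrA exprS.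
apply: eq_bigr => l _; rewrite mulrA; congr (_ * _).
by apply/commr_sym/comm_elsym => j; apply/commr_sym/commrX.
Qed.

(** Each power is reduced to exponents below n, and the product is expanded over the exponent
    functions [f]. *)
Lemma xspan_finite u : xspan u ->
  exists2 e : {ffun 'I_n -> 'I_n} -> D, forall f,
    E (e f) & u = \sum_(f : {ffun 'I_n -> 'I_n}) xmono (fun i => f i) * e f.
Proof.
elim=> {u} [a e Ee|u v _ [eu Eu ->] _ [ev Ev ->]]; last first.
  exists (fun f => eu f + ev f); first by move=> f; apply: ED.
  by rewrite -big_split; apply: eq_bigr => f _; rewrite mulrDr.
have [c cP] := boolp.choice (fun i => x_exp_reduce i (a i)).
exists (fun f : {ffun 'I_n -> 'I_n} => (\prod_i c i (f i)) * e).
  move=> f; apply: EM => //; apply: (division_subalg_prod EP) => i _.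
  by have [/(_ (f i)) []] := cP i.
rewrite /xmono; under eq_bigr do rewrite (cP _).2.
rewrite bigA_distr_bigA mulr_suml; apply: eq_bigr => f _.
rewrite mulrA prodrM_comm // => i j _ _; apply: commr_sym; apply: commrX.
by have [/(_ (f j)) []] := cP j.
Qed.

Definition xspan_stable u := forall v, xspan v -> xspan (u * v).

Lemma xspan_stableD u v : xspan_stable u -> xspan_stable v -> xspan_stable (u + v).
Proof. by move=> hu hv w hw; rewrite mulrDl; apply: xspanD; [apply: hu | apply: hv]. Qed.

Lemma xspan_stableM u v : xspan_stable u -> xspan_stable v -> xspan_stable (u * v).
Proof. by move=> hu hv w hw; rewrite -mulrA; apply/hu/hv. Qed.

Lemma xspan_stableZ c u : xspan_stable u -> xspan_stable (c *: u).
Proof.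
move=> hu v hv; rewrite -scalerAl -[_ * _]mulr1 scalerAr; apply: xspan_Mr; first exact: hu.
by case: EP => _ _ _ _; apply.
Qed.

Lemma xspan_stable1 : xspan_stable 1.
Proof. by move=> v; rewrite mul1r. Qed.

Lemma xspan_stable0 : xspan_stable 0.
Proof. by rewrite -(scale0r 1); apply/xspan_stableZ/xspan_stable1. Qed.

Lemma xspan_stableB u v : xspan_stable u -> xspan_stable v -> xspan_stable (u - v).
Proof. by move=> hu hv; apply: xspan_stableD => //; rewrite -scaleN1r; apply: xspan_stableZ. Qed.

Lemma xspan_stableV u : xspan_stable u -> u != 0 -> xspan_stable u^-1.
Proof.
move=> hu u0 v hv; apply: (left_inverse_stable divD EP _ _ xspan_finite) hv => //.
- by move=> *; apply: xspanD.
- by move=> *; apply: xspan_Mr.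
Qed.

Lemma xspan_stable_sum (I : Type) (r : seq I) (P : pred I) (F : I -> D) :
  (forall i, P i -> xspan_stable (F i)) -> xspan_stable (\sum_(i <- r | P i) F i).
Proof. by apply: big_ind; [exact: xspan_stable0 | exact: xspan_stableD]. Qed.

Lemma xspan_stable_prod (I : Type) (r : seq I) (P : pred I) (F : I -> D) :
  (forall i, P i -> xspan_stable (F i)) -> xspan_stable (\prod_(i <- r | P i) F i).
Proof. by apply: big_ind; [exact: xspan_stable1 | exact: xspan_stableM]. Qed.

Lemma xspan_stable_coef (r : seq 'I_n) (P : pred 'I_n) l :
  xspan_stable (\prod_(i <- r | P i) ('X - (x i)%:P))`_l.
Proof.
elim: r l => [|i r IH] l.
  by rewrite big_nil coef1; case: (l == 0%N); [exact: xspan_stable1 | exact: xspan_stable0].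
rewrite big_cons; case: ifP => // _; rewrite mulrBl coefB coefXM coefCM.
apply: xspan_stableB; first by case: ifP => // _; exact: xspan_stable0.
by apply: xspan_stableM => // v; apply: xspan_x.
Qed.

Lemma xspan_stable_dual l m : xspan_stable (dual_coef x l m).
Proof.
apply: xspan_stableM.
  elim: l => [|l IH]; first exact: xspan_stable1.
  by rewrite exprS; apply: xspan_stableM => // v; apply: xspan_x.
apply: xspan_stableV; last first.
  apply: contraTneq (lagrange_den_unit xC (weyl_xU divD WR) m) => ->.
  by rewrite unitr0.
rewrite (lagrange_denE xC); apply: xspan_stable_prod => i _.
by apply: xspan_stableB => v; apply: xspan_x.
Qed.

(** On [E] this is multiplication inside [E]; passing a letter x_i leaves the term
    [dual_coef x l i], a stable fraction in the x_j. *)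
Lemma xspan_stable_der l : xspan_stable (elsym_der x d l).
Proof.
apply: xspan_ind_x => [e Ee|i u hu IH|u v hu hv].
- exact/xspan_E/EM.
- have -> : elsym_der x d l * (x i * u) = x i * (elsym_der x d l * u) + dual_coef x l i * u.
    by rewrite -(bracket_elsym_der_x WR) bracketE mulrBl !mulrA addrC subrK.
  by apply: xspanD; [apply: xspan_x | apply: xspan_stable_dual].
- by rewrite mulrDr; apply: xspanD.
Qed.

Lemma xspan_stable_weyl u : in_weyl x d u -> xspan_stable u.
Proof.
move=> [N [c ->]].
apply: (weyl_sub_closure _ _ _ _ _ _ (weyl_sub_in_weyl WR c)).
- exact: xspan_stable1.
- by move=> i v; apply: xspan_x.
- move=> i; rewrite (d_elsym_der divD WR i); apply: xspan_stable_sum => l _.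
  by apply: xspan_stableM; [apply: xspan_stable_coef | apply: xspan_stable_der].
- exact: xspan_stableD.
- exact: xspan_stableM.
- exact: xspan_stableZ.
Qed.

Lemma xspan_full q : xspan q.
Proof.
have [a [b [/xspan_stable_weyl ha /xspan_stable_weyl hb b0 ->]]] := WF q.
by rewrite -[b^-1]mulr1; apply/ha/xspan_stableV/xspan_E.
Qed.

End Spanning.

(** * Symmetrized monomials *)

Lemma perm_prod_comm (R : pzRingType) (I : eqType) (r1 r2 : seq I) (F : I -> R) :
    (forall i j, GRing.comm (F i) (F j)) -> perm_eq r1 r2 ->
  \prod_(i <- r1) F i = \prod_(i <- r2) F i.
Proof.
move=> FC; elim: r1 r2 => [|i r IH] r2; first by move/perm_size/esym/size0nil ->.
move=> p; have ir2 : i \in r2 by rewrite -(perm_mem p) mem_head.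
case/splitPr: ir2 p => s t p.
rewrite big_cons big_cat big_cons /= mulrA -(commr_prod _ (fun j _ => FC i j)) -mulrA -big_cat.
congr (_ * _); apply: IH; rewrite -(perm_cons i); apply: perm_trans p _.
by rewrite -[i :: t]cat1s perm_catCA.
Qed.

Lemma reindex_prod_comm (R : pzRingType) (n : nat) (F : 'I_n -> R) (s : 'S_n) :
  (forall i j, GRing.comm (F i) (F j)) -> \prod_i F (s i) = \prod_i F i.
Proof.
move=> FC; rewrite -(big_map s xpredT F); apply: perm_prod_comm => //.
apply: uniq_perm; rewrite ?map_inj_uniq ?index_enum_uniq //; first exact: perm_inj.
move=> i; rewrite mem_index_enum; apply/mapP; exists (s^-1%g i); rewrite ?mem_index_enum //.
by rewrite permKV.
Qed.

(** Inclusion-exclusion: expand the product over j of 1, or of 1 - 1 when [f] misses j. It is 1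
    exactly when [f] is onto, that is, injective. *)
Lemma sum_sign_ffun_on (k : fieldType) (n : nat) (f : {ffun 'I_n -> 'I_n}) :
  \sum_(S : {set 'I_n}) (-1) ^+ #|~: S| *+ (f \in ffun_on (mem S)) = (injectiveb f)%:R :> k.
Proof.
transitivity (\prod_j (1 + (if j \in codom f then 0 else -1)) : k).
  rewrite bigA_distr; apply: eq_bigr => S _.
  have [/ffun_onP fS | fS] := boolP (f \in _).
    rewrite mulr1n -prodr_const [RHS](bigID (fun j => j \in S)) /= [X in _ = X * _]big1 ?mul1r
      => [|j -> //].
    apply: congr_big => // [j|j jS]; first by rewrite inE.
    move: jS; rewrite inE => /negPf jS; rewrite jS; case: ifP => // /codomP[i ji].
    by rewrite ji (fS i) in jS.
  have /existsP[i fi] : [exists i, f i \notin S].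
    by apply: contraR fS; rewrite negb_exists => /forallP fS; apply/ffun_onP => i;
      have := fS i; rewrite negbK.
  by rewrite mulr0n (bigD1 (f i)) //= (negPf fi) codom_f mul0r.
have [/injectiveP fI | fI] := boolP (injectiveb f).
  apply: big1 => j _; suff -> : j \in codom f by rewrite addr0.
  exact: inj_card_onto.
suff /existsP[j jf] : [exists j, j \notin codom f].
  by rewrite (bigD1 j) //= (negPf jf) subrr mul0r.
apply: contraR fI; rewrite negb_exists => /forallP fS; apply/injectiveP.
have : #|image f 'I_n| == #|'I_n|.
  apply/eqP; apply: eq_card => j; rewrite inE; have := fS j; rewrite negbK //.
by move/image_injP => fI i j; apply: fI.
Qed.

(** The products expand over the maps with values in [S], and the signs leave the injective ones.
    Factors keep the order of the rows, so this holds over a noncommutative [D]. *)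
Lemma permanent_ryser (k : fieldType) (D : unitAlgType k) (n : nat) (A : 'I_n -> 'I_n -> D) :
  \sum_(s : 'S_n) \prod_i A i (s i) =
  \sum_(S : {set 'I_n}) (-1) ^+ #|~: S| *: \prod_i \sum_(j in S) A i j.
Proof.
under [RHS]eq_bigr => S _ do rewrite bigA_distr_big scaler_sumr big_mkcond.
rewrite exchange_big /=.
transitivity (\sum_(f : {ffun 'I_n -> 'I_n}) (injectiveb f)%:R *: \prod_i A i (f i)).
  rewrite (bigID (fun f : {ffun 'I_n -> 'I_n} => injectiveb f)) /= [X in _ = _ + X]big1 ?addr0;
    last first.
    by move=> f /negPf ->; rewrite scale0r.
  rewrite (reindex (@pval _)) /=; last first.
    pose in_Sn := insubd (1%g : 'S_n).
    by exists in_Sn => /= f Uf; first apply: val_inj; apply: insubdK.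
  apply: eq_big => /= [s | s _]; rewrite (valP s) // scale1r.
  by apply: eq_bigr => i _; rewrite pvalE.
apply: eq_bigr => f _; rewrite -sum_sign_ffun_on scaler_suml; apply: eq_bigr => S _.
by case: (f \in _); rewrite ?mulr1n // mulr0n scale0r.
Qed.

Section Symmetrization.
Variables (k : closedFieldType) (D : unitAlgType k) (n : nat) (x : 'I_n -> D) (E : D -> Prop).
Hypothesis EP : division_subalg E.
Hypothesis xC : forall i j, GRing.comm (x i) (x j).
Hypothesis Eelsym : forall l, E (elsym x l).

Let E1 : E 1. Proof. by case: EP. Qed.
Let EM u v : E u -> E v -> E (u * v). Proof. by case: EP => _ _ h _ _; apply: h. Qed.
Let EZ c u : E u -> E (c *: u). Proof. by case: EP => _ _ _ _ h; apply: h. Qed.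

(** Up to sign this is P(z), and the coefficients of P are 1 and the [- elsym x l]. *)
Lemma subalg_prod_sub_scalar (z : k) : E (\prod_i (x i - z%:A)).
Proof.
have zc (u : D) : GRing.comm z%:A u by exact: comm_alg.
have -> : \prod_i (x i - z%:A) = (-1) ^+ n * (vieta_poly x).[z%:A].
  rewrite /vieta_poly (horner_prod_XsubC_comm _ _ (fun i => zc (x i))).
  transitivity (\prod_(i < n) ((-1) * (z%:A - x i))).
    by apply: eq_bigr => i _; rewrite mulN1r opprB.
  by rewrite prodrM_comm ?prodr_const ?card_ord // => i j _ _; apply/commr_sym/commrN1.
apply: EM.
  by apply: (division_subalg_exp EP); rewrite -scaleN1r; apply: EZ.
have sv : (size (vieta_poly x) <= n.+1)%N.
  by rewrite /vieta_poly size_prod_XsubC /index_enum -enumT size_enum_ord.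
rewrite (horner_coef_wide _ sv); apply: (division_subalg_sum EP) => l _; apply: EM; last first.
  by apply: (division_subalg_exp EP); apply: EZ.
case: (unliftP ord_max l) => [j|] ->.
  by rewrite lift_max -[X in E X]opprK; apply: (division_subalgN EP); apply: Eelsym.
have /monicP : vieta_poly x \is monic by apply: monic_prod_XsubC.
by rewrite /lead_coef /vieta_poly size_prod_XsubC /index_enum -enumT size_enum_ord /= => ->.
Qed.

Lemma comm_horner_alg (u a : D) (p : {poly k}) :
  GRing.comm u a -> GRing.comm u (horner_alg a p).
Proof.
move=> ua; apply: commr_horner => // i.
by rewrite coef_map; apply: comm_alg.
Qed.

(* Over the algebraically closed field [k], the norm of [g(x_i)] is a product of
   values [\prod_i (x i - z)] of the Vieta polynomial. *)
Lemma subalg_norm (g : {poly k}) : E (\prod_i horner_alg (x i) g).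
Proof.
have [r ->] := closed_field_poly_normal g; move: (lead_coef g) => c.
under eq_bigr do rewrite linearZ /=.
rewrite prodrM_comm => [|i j _ _]; last exact: comm_alg.
apply: EM; first by apply: (division_subalg_prod EP) => i _; apply: EZ.
elim: r => [|z r IH].
  by apply: (division_subalg_prod EP) => i _; rewrite big_nil rmorph1.
under eq_bigr do rewrite big_cons rmorphM rmorphB /= horner_algX horner_algC.
rewrite prodrM_comm => [|i j _ _]; first by apply: EM => //; apply: subalg_prod_sub_scalar.
apply: comm_horner_alg; apply/commr_sym/commrB => //.
by apply/commr_sym/comm_alg.
Qed.

(** The permanent of the matrix x_i^(a_j). In Ryser's formula row i sums over [S] to g(x_i) with one
    polynomial g for all i, so [subalg_norm] applies. *)
Lemma subalg_symmetrized_mono (a : 'I_n -> nat) : E (\sum_(s : 'S_n) \prod_i x (s i) ^+ a i).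
Proof.
have -> : \sum_(s : 'S_n) \prod_i x (s i) ^+ a i = \sum_(s : 'S_n) \prod_i x i ^+ a (s i).
  rewrite (reindex_inj invg_inj) /=; apply: eq_bigr => s _.
  rewrite -(reindex_prod_comm s (F := fun i => x ((s^-1)%g i) ^+ a i)); last first.
    by move=> i j; apply/commrX/commr_sym/commrX.
  by apply: eq_bigr => i _; rewrite permK.
rewrite (permanent_ryser (fun i j => x i ^+ a j)); apply: (division_subalg_sum EP) => S _.
apply: EZ; rewrite (eq_bigr (fun i => horner_alg (x i) (\sum_(j in S) 'X^(a j))));
  first exact: subalg_norm.
by move=> i _; rewrite raddf_sum; apply: eq_bigr => j _; rewrite /= rmorphXn /= horner_algX.
Qed.

End Symmetrization.

(** * The isomorphism *)

Lemma alg_hom_lrmorphism (k : fieldType) (D : unitAlgType k) (f : D -> D) :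
  is_alg_hom f -> exists F : {lrmorphism D -> D}, f = F.
Proof.
move=> [f1 fD fM fZ].
have fB : zmod_morphism f by move=> u v; rewrite fD -scaleN1r fZ scaleN1r.
pose add := GRing.isZmodMorphism.Build D D f fB.
pose mul := GRing.isMonoidMorphism.Build D D f (f1, fM).
pose scal := GRing.isScalable.Build k D D *:%R f fZ.
pose F : {lrmorphism D -> D} := HB.pack f add mul scal.
by exists F.
Qed.

(** * Invariance of the coordinates and of their vector fields *)

Section PermutationAction.
Variables (k : fieldType) (D : unitAlgType k) (n : nat) (x d : 'I_n -> D).
Hypothesis divD : is_division_ring D.
Hypothesis WR : weyl_relations x d.
Variables (s : 'S_n) (F : {lrmorphism D -> D}).
Hypothesis Fx : forall i, F (x i) = x (s i).
Hypothesis Fd : forall i, F (d i) = d (s i).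

Lemma elsym_fixed l : F (elsym x l) = elsym x l.
Proof.
have Fv : map_poly F (vieta_poly x) = vieta_poly x.
  rewrite rmorph_prod; under eq_bigr do rewrite /= map_polyXsubC /= Fx.
  rewrite (reindex_prod_comm s (F := fun i => 'X - (x i)%:P)) //.
  by apply: comm_XsubC; apply: weyl_xC WR.
by rewrite /elsym rmorphN /= -[in RHS]Fv coef_map.
Qed.

(** The image under [F] is again a vector field, with the same values on the fixed elements [elsym];
    [der_eq0] kills the difference. *)
Lemma elsym_der_fixed l : F (elsym_der x d l) = elsym_der x d l.
Proof.
have xC := weyl_xC WR.
have Fder : F (elsym_der x d l) = \sum_m F (dual_coef x l ((s^-1)%g m)) * d m.
  rewrite /elsym_der rmorph_sum (reindex_inj (@perm_inj _ s^-1%g)) /=.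
  by apply: eq_bigr => m _; rewrite rmorphM /= Fd permKV.
have E : F (elsym_der x d l) - elsym_der x d l =
    \sum_m (F (dual_coef x l ((s^-1)%g m)) - dual_coef x l m) * d m.
  by rewrite Fder -sumrB; apply: eq_bigr => m _; rewrite mulrBl.
apply/eqP; rewrite -subr_eq0 E; apply/eqP.
apply: (der_eq0 divD WR) => [m i|r].
  apply/commr_sym/commrB; last exact: comm_x_dual WR _ _ _.
  rewrite -(permKV s i) -Fx /GRing.comm -!rmorphM /=; congr (F _).
  exact: comm_x_dual WR _ _ _.
rewrite -E bracketDl bracketNl -{1}elsym_fixed.
have -> : bracket (F (elsym_der x d l)) (F (elsym x r)) = F (bracket (elsym_der x d l) (elsym x r)).
  by rewrite !bracketE rmorphB !rmorphM.
by rewrite (bracket_elsym_der_elsym divD WR) rmorph_nat subrr.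
Qed.

End PermutationAction.

Lemma division_hom_inj (k : fieldType) (D : unitAlgType k) (f : {lrmorphism D -> D}) :
  is_division_ring D -> injective f.
Proof.
move=> divD u v fuv; apply/eqP; rewrite -subr_eq0; apply: contraT => /divD /(rmorph_unit f).
by rewrite rmorphB /= fuv subrr unitr0.
Qed.

Lemma division_subalg_image (k : fieldType) (D : unitAlgType k) (f : {lrmorphism D -> D}) :
  is_division_ring D -> division_subalg (fun p => exists q, p = f q).
Proof.
move=> divD; split.
- by exists 1; rewrite rmorph1.
- by move=> _ _ [u ->] [v ->]; exists (u + v); rewrite rmorphD.
- by move=> _ _ [u ->] [v ->]; exists (u * v); rewrite rmorphM.
- move=> _ [u ->]; exists u^-1; have [->|/divD uU] := eqVneq u 0; last by rewrite rmorphV.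
  by rewrite invr0 rmorph0 invr0.
- by move=> c _ [u ->]; exists (c *: u); rewrite linearZ.
Qed.

(* D_n^{S_n} is isomorphic (as a k-algebra) to D_n: there is an injective
   k-algebra homomorphism f : D_n -> D_n whose image is exactly D_n^{S_n}. *)
Theorem theorem4p1 (k : closedFieldType) (hchar : [pchar k] =i pred0)
    (n : nat) (hn : (0 < n)%N)
    (D : unitAlgType k) (x d : 'I_n -> D) (sigma : 'S_n -> D -> D) :
  is_weyl_skew_field x d ->
  is_Sn_action x d sigma ->
  exists f : D -> D,
    [/\ is_alg_hom f, injective f,
        forall q, Sn_invariant sigma (f q) &
        forall q, Sn_invariant sigma q -> exists p, f p = q].
Proof.
case: n hn x d sigma => // n _ x d sigma [divD WR _ WF] act.
have [g [homg gx gd]] := weyl_hom_exists hchar divD WR WF (weyl_relations_elsym divD WR).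
have [f fE] := alg_hom_lrmorphism homg; move: homg gx gd; rewrite {g}fE => homf fx fd.
have EP := division_subalg_image f divD.
have invE s q : sigma s (f q) = f q.
  have [homs _ sx sd] := act s.
  have [F FE] := alg_hom_lrmorphism homs; rewrite FE in sx sd *.
  (* Invariance is checked on generators, which settles the Weyl algebra, and then passes to
     fractions. *)
  have fixA u : in_weyl x d u -> F (f u) = f u.
    move=> [N [c ->]].
    apply: (weyl_sub_closure (Q := fun u => F (f u) = f u) _ _ _ _ _ _ (weyl_sub_in_weyl WR c)).
    - by rewrite !rmorph1.
    - by move=> i; rewrite fx (elsym_fixed WR sx).
    - by move=> i; rewrite fd (elsym_der_fixed divD WR sx sd).
    - by move=> u1 u2 h1 h2; rewrite !rmorphD /= h1 h2.
    - by move=> u1 u2 h1 h2; rewrite !rmorphM /= h1 h2.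
    - by move=> a u1 h1; rewrite !linearZ /= h1.
  have [a [b [/fixA ha /fixA hb b0 ->]]] := WF q.
  by rewrite !rmorphM /= !rmorphV ?rmorph_unit ?divD //= ha hb.
exists f; split=> // [|q s|q qinv]; [exact: division_hom_inj | exact: invE |].
(* The order of the group is invertible in characteristic 0. *)
suff [p Ep] : exists p, q *+ #|'S_n.+1| = f p.
  exists (#|'S_n.+1|%:R^-1 *: p); rewrite linearZ /= -Ep -scaler_nat scalerA mulVf ?scale1r //.
  by rewrite (pcharf0P k).1 // -lt0n card_Sn fact_gt0.
have -> : q *+ #|'S_n.+1| = \sum_(s : 'S_n.+1) sigma s q.
  by rewrite (eq_bigr (fun=> q)) ?sumr_const // => s _; apply: qinv.
have Eelsym l : exists q, elsym x l = f q by exists (x l); rewrite fx.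
have Eder l : exists q, elsym_der x d l = f q by exists (d l); rewrite fd.
(* The sum over the group is additive in [q], so induction over the span applies although its
   members need not be invariant. In the monomial case [f e] is fixed and factors out. *)
elim: (xspan_full divD WR WF EP Eelsym Eder q) => {q qinv} [a _ [e ->]|u v _ [pu Eu] _ [pv Ev]].
  have -> : \sum_(s : 'S_n.+1) sigma s (xmono x a * f e) =
      (\sum_(s : 'S_n.+1) \prod_i x (s i) ^+ a i) * f e.
    rewrite mulr_suml; apply: eq_bigr => s _; have [homs _ sx _] := act s.
    have fe := invE s e; have [F FE] := alg_hom_lrmorphism homs; rewrite FE in sx fe *.
    rewrite rmorphM /= fe rmorph_prod; congr (_ * _).
    by apply: eq_bigr => i _; rewrite rmorphXn /= sx.
  have [p ->] := subalg_symmetrized_mono EP (weyl_xC WR) Eelsym a.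
  by exists (p * e); rewrite rmorphM.
exists (pu + pv); rewrite rmorphD /= -Eu -Ev -big_split; apply: eq_bigr => s _ /=.
by case: (act s) => -[].
Qed.
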